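(* Let $A\in\mathbb{B}(\mathscr{H})$ be a generalized projection and $B\in\mathbb{B}(\mathscr{H})$. Then $B\stackrel{*}{\leq}AA^*$ if and only if $B$ is an idempotent and there exists an idempotent $X\in\mathbb{B}(\mathscr{H})$ such that $AA^*=B+X$ and $B^*X=XB^*=0$.
   Context: $\mathscr{H}$ is a complex Hilbert space and $\mathbb{B}(\mathscr{H})$ is the space of bounded linear operators on $\mathscr{H}$. An operator $A\in\mathbb{B}(\mathscr{H})$ is a generalized projection if $A^2=A^*$; an idempotent is an operator $E$ with $E^2=E$ (not necessarily self-adjoint). For $C,D\in\mathbb{B}(\mathscr{H})$, the $*$-order $C\stackrel{*}{\leq}D$ means $CC^*=DC^*$ and $C^*C=C^*D$. *)

(* Defs.v *)
From HB Require Import structures.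
From mathcomp Require Import all_boot all_order all_algebra.
From mathcomp Require Import ring lra.
From mathcomp Require Import complex.
From mathcomp Require Import boolp classical_sets functions reals topology.
From mathcomp Require Import interval_inference.
From mathcomp Require Import normedtype sequences.

Set Implicit Arguments.
Unset Strict Implicit.
Unset Printing Implicit Defensive.

Import Order.TTheory GRing.Theory Num.Theory.
Import numFieldNormedType.Exports.
Local Open Scope ring_scope.

Reserved Notation "''B' ( H )" (at level 8, format "''B' ( H )").

(* A complex Hilbert space: a complete normed space over R[i] whose norm is
   induced by a positive definite Hermitian form, linear in its first
   argument and conjugate-linear in its second one. *)
HB.mixin Record NormedModule_isHilbert (R : realType) H
    of CompleteNormedModule R[i] H := {
  dotH : {dot H for @Num.conj_op R[i]};
  sqr_norm_dotH : forall x : H, `|x| ^+ 2 = dotH x x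
}.

#[short(type="hilbertType")]
HB.structure Definition Hilbert (R : realType) :=
  {H of NormedModule_isHilbert R H & CompleteNormedModule R[i] H}.

Section BoundedOperators.
Variables (R : realType) (H : hilbertType R).

Definition bounded_map (f : H -> H) :=
  exists M : R[i], forall x, `|f x| <= M * `|x|.

Record bounded_op := BoundedOp {
  bop_fun :> H -> H;
  bop_linear : linear bop_fun;
  bop_bounded : bounded_map bop_fun }.

HB.instance Definition _ (T : bounded_op) :=
  GRing.isLinear.Build R[i] H H _ (bop_fun T) (bop_linear T).

Implicit Types S T U : bounded_op.

Lemma bopP S T : S =1 T -> S = T.
Proof.
case: S T => [f fl fb] [g gl gb] /= /funext fg; rewrite fg in fl fb *.
by congr BoundedOp; exact: Prop_irrelevance.
Qed.

Lemma bounded_map_ge0 (f : H -> H) : bounded_map f ->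
  exists2 M : R[i], 0 <= M & forall x, `|f x| <= M * `|x|.
Proof.
move=> [M fM]; exists `|M| => // x.
by rewrite -[X in _ <= _ * X]normr_id -normrM; exact/(le_trans (fM x))/real_ler_norm/ger0_real/(le_trans _ (fM x)).
Qed.

Lemma bop0_linear : linear (fun _ : H => 0 : H).
Proof. by move=> a x y; rewrite scaler0 addr0. Qed.

Lemma bop0_bounded : bounded_map (fun _ : H => 0 : H).
Proof. by exists 0 => x; rewrite normr0 mul0r. Qed.

Definition bop0 := BoundedOp bop0_linear bop0_bounded.

Lemma bop1_linear : linear (fun x : H => x).
Proof. by []. Qed.

Lemma bop1_bounded : bounded_map (fun x : H => x).
Proof. by exists 1 => x; rewrite mul1r. Qed.

Definition bop1 := BoundedOp bop1_linear bop1_bounded.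

Lemma bopN_linear T : linear (fun x => - T x).
Proof. by move=> a x y; rewrite linearP opprD scalerN. Qed.

Lemma bopN_bounded T : bounded_map (fun x => - T x).
Proof. by have [M TM] := bop_bounded T; exists M => x; rewrite normrN. Qed.

Definition bopN T := BoundedOp (bopN_linear T) (bopN_bounded T).

Lemma bopD_linear S T : linear (fun x => S x + T x).
Proof. by move=> a x y; rewrite !linearP scalerDr addrACA. Qed.

Lemma bopD_bounded S T : bounded_map (fun x => S x + T x).
Proof.
have [[M SM] [N TN]] := (bop_bounded S, bop_bounded T); exists (M + N) => x.
by rewrite mulrDl (le_trans (ler_normD _ _))// lerD.
Qed.

Definition bopD S T := BoundedOp (bopD_linear S T) (bopD_bounded S T).

Lemma bopM_linear S T : linear (fun x => S (T x)).
Proof. by move=> a x y; rewrite !linearP. Qed.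

Lemma bopM_bounded S T : bounded_map (fun x => S (T x)).
Proof.
have [M M0 SM] := bounded_map_ge0 (bop_bounded S).
have [N TN] := bop_bounded T; exists (M * N) => x.
by rewrite (le_trans (SM _))// -mulrA ler_wpM2l.
Qed.

Definition bopM S T := BoundedOp (bopM_linear S T) (bopM_bounded S T).

HB.instance Definition _ := gen_eqMixin bounded_op.
HB.instance Definition _ := gen_choiceMixin bounded_op.

Lemma bopDA : associative bopD.
Proof. by move=> S T U; apply: bopP => x /=; rewrite addrA. Qed.

Lemma bopDC : commutative bopD.
Proof. by move=> S T; apply: bopP => x /=; rewrite addrC. Qed.

Lemma bop0D : left_id bop0 bopD.
Proof. by move=> S; apply: bopP => x /=; rewrite add0r. Qed.

Lemma bopND : left_inverse bop0 bopN bopD.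
Proof. by move=> S; apply: bopP => x /=; rewrite addNr. Qed.

HB.instance Definition _ :=
  GRing.isZmodule.Build bounded_op bopDA bopDC bop0D bopND.

Lemma bopMA : associative bopM.
Proof. by move=> S T U; apply: bopP. Qed.

Lemma bop1M : left_id bop1 bopM.
Proof. by move=> S; apply: bopP. Qed.

Lemma bopM1 : right_id bop1 bopM.
Proof. by move=> S; apply: bopP. Qed.

Lemma bopMDl : left_distributive bopM bopD.
Proof. by move=> S T U; apply: bopP. Qed.

Lemma bopMDr : right_distributive bopM bopD.
Proof. by move=> S T U; apply: bopP => x; exact: linearD. Qed.

(* The product is composition; H may be trivial, so 1 = 0 is allowed. *)
HB.instance Definition _ :=
  GRing.Zmodule_isPzRing.Build bounded_op bopMA bop1M bopM1 bopMDl bopMDr.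

Lemma bop0E x : (0 : bounded_op) x = 0. Proof. by []. Qed.
Lemma bop1E x : (1 : bounded_op) x = x. Proof. by []. Qed.
Lemma bopNE T x : (- T) x = - T x. Proof. by []. Qed.
Lemma bopDE S T x : (S + T) x = S x + T x. Proof. by []. Qed.
Lemma bopME S T x : (S * T) x = S (T x). Proof. by []. Qed.

End BoundedOperators.

Notation "''B' ( H )" := (bounded_op H) : type_scope.

Section Adjoint.
Variables (R : realType) (H : hilbertType R).
Implicit Types (x y z h : H) (a t : R).

Local Notation rdot x y := (complex.Re (dotH x y)).

Lemma dotHC x y : dotH x y = conjc (dotH y x).
Proof. by rewrite (@hermC _ _ Num.conj_op _ dotH) expr0 mul1r. Qed.

Let rdotC x y : rdot x y = rdot y x.
Proof. by rewrite dotHC; case: (dotH y x). Qed.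

Let rdotDl x y z : rdot (x + y) z = rdot x z + rdot y z.
Proof. by rewrite linearDl raddfD. Qed.

Let rdotZl a x y : rdot (a%:C%C *: x) y = a * rdot x y.
Proof. by rewrite linearZl_LR /=; case: (dotH x y) => u v /=; rewrite mul0r subr0. Qed.

Let rdotDr x y z : rdot x (y + z) = rdot x y + rdot x z.
Proof. by rewrite rdotC rdotDl !(rdotC _ x). Qed.

Let rdotZr a x y : rdot x (a%:C%C *: y) = a * rdot x y.
Proof. by rewrite rdotC rdotZl rdotC. Qed.

Let dotHxx x : dotH x x = (rdot x x)%:C%C.
Proof.
by rewrite RRe_real// -sqr_norm_dotH ger0_real// exprn_ge0.
Qed.

Let sqr_normE x : `|x| ^+ 2 = (rdot x x)%:C%C.
Proof. by rewrite sqr_norm_dotH dotHxx. Qed.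

Let rdot_ge0 x : 0 <= rdot x x.
Proof. by rewrite -lecR -sqr_normE exprn_ge0. Qed.


Let norm_lt x (e : R) : 0 < e -> (`|x| < e%:C%C) = (rdot x x < e ^+ 2).
Proof.
move=> e0; rewrite -(@ltr_pXn2r _ 2)// ?nnegrE//.
  by rewrite sqr_normE -rmorphXn ltcR.
by rewrite ler0c ltW.
Qed.

Let posCE (e : R[i]) : 0 < e -> exists2 r : R, 0 < r & e = r%:C%C.
Proof.
move=> e0; exists (complex.Re e); last by rewrite RRe_real// gtr0_real.
by rewrite -ltcR RRe_real// gtr0_real.
Qed.

(* Weak discriminant bound; the +1 avoids the degenerate case a = 0. *)
Let discr (a b c : R) : 0 <= a -> 0 <= c ->
  (forall t, 0 <= a * t ^+ 2 + 2 * b * t + c) -> b ^+ 2 <= (a + 1) * c.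
Proof.
move=> a0 c0 /(_ (- b / (a + 1))).
have a1 : 0 < a + 1 by lra.
have -> : a * (- b / (a + 1)) ^+ 2 + 2 * b * (- b / (a + 1)) + c =
   ((a + 1) ^+ 2 * c - (a + 2) * b ^+ 2) / (a + 1) ^+ 2.
  by field; rewrite gt_eqF.
rewrite pmulr_lge0 ?invr_gt0 ?exprn_gt0// => h.
rewrite -(ler_pM2l a1); have := sqr_ge0 b; lra.
Qed.

Let sqr_rdot x y : rdot x y ^+ 2 <= rdot x x * rdot y y.
Proof.
have x0 := rdot_ge0 x; have y0 := rdot_ge0 y.
have := rdot_ge0 ((rdot y y)%:C%C *: x + (- rdot x y)%:C%C *: y).
rewrite !(rdotDl, rdotDr, rdotZl, rdotZr) (rdotC y x) => h.
have [y1|y1] := ltP 0 (rdot y y); first by rewrite -subr_ge0 -(pmulr_rge0 _ y1); lra.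
have {y0 y1}y0 : rdot y y = 0 by lra.
have {h y0} -> : y = 0.
  apply/eqP; rewrite -normr_eq0 -sqrf_eq0 sqr_normE y0.
  by rewrite rmorph0.
by rewrite !linear0r !raddf0 mulr0 expr2 mul0r.
Qed.

(* Riesz representation for the real form rdot: the representing vector
   minimizes rdot x x - 2 * F x. *)
Section Riesz.
Variables (F : H -> R) (K : R).
Hypothesis FD : forall x y, F (x + y) = F x + F y.
Hypothesis FZ : forall t x, F (t%:C%C *: x) = t * F x.
Hypothesis F_bounded : forall x, F x ^+ 2 <= K * rdot x x.
Hypothesis K0 : 0 <= K.

Let q x : R := rdot x x - 2 * F x.

Let q_lb : has_lbound (range q).
Proof.
exists (- K) => _ [x _ <-]; rewrite /q.
have := F_bounded x; have := rdot_ge0 x; move: (rdot x x) (F x) K0 => a b K0' a0 h.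
have := sqr_ge0 (a - K); rewrite leNgt => aK; apply/negP => h'.
have : (a + K) ^+ 2 < (2 * b) ^+ 2 by rewrite ltr_pXn2r ?nnegrE//; lra.
by lra.
Qed.

Let d := inf (range q).

Let d_le x : d <= q x.
Proof. by apply: ge_inf => //; exists x. Qed.

Let near_min (n : nat) : exists x, q x < d + n.+1%:R^-1.
Proof.
have hi : has_inf (range q) by split => //; exists (q 0), 0.
have [_ [x _ <-] xd] := @inf_adherent _ (range q) n.+1%:R^-1 ltac:(by []) hi.
by exists x.
Qed.

Let u n := sval (cid (near_min n)).

Let u_lt n : q (u n) < d + n.+1%:R^-1.
Proof. by rewrite /u; case: cid. Qed.

Let rdot_sub m n :
  rdot (u m - u n) (u m - u n) <= 2 * (m.+1%:R^-1 + n.+1%:R^-1).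
Proof.
have := d_le ((2^-1)%:C%C *: (u m + u n)); have := u_lt m; have := u_lt n.
have -> : u m - u n = u m + (- 1)%:C%C *: u n by rewrite rmorphN1 scaleN1r.
rewrite /q !(rdotDl, rdotDr, rdotZl, rdotZr, FZ, FD) (rdotC (u n) (u m)).
move: (rdot (u m) (u m)) (rdot (u m) (u n)) (rdot (u n) (u n)) => a b c.
move: d (F (u n)) (F (u m)) (n.+1%:R^-1) (m.+1%:R^-1) => d' f g e e'; lra.
Qed.

Let u_cvg : exists z, forall e : R, 0 < e ->
  exists n, n.+1%:R^-1 < e /\ rdot (z - u n) (z - u n) < e.
Proof.
have : cvg (u @ \oo)%classic.
  apply/cauchy_cvgP/cauchy_exP => e /posCE[r r0 ->].
  have r2 : 0 < r ^+ 2 / 4 by rewrite divr_gt0// exprn_gt0.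
  have [N _ NP] := near_infty_natSinv_lt (PosNum r2).
  exists (u N); exists N => // n Nn.
  rewrite -ball_normE /= norm_lt// (le_lt_trans (rdot_sub _ _))//.
  have := NP n Nn; have := NP N (leqnn N) => /=.
  by move: (N.+1%:R^-1) (n.+1%:R^-1) => a b; lra.
move=> /cvg_ex[z /cvgrPdist_lt uz]; exists z => e e0.
have s0 : 0 < Num.sqrt e by rewrite sqrtr_gt0.
have /uz[N _ NP] : 0 < (Num.sqrt e)%:C%C by rewrite ltcR.
have [M _ MP] := near_infty_natSinv_lt (PosNum e0).
exists (maxn M N); split; first exact/MP/leq_maxl.
by have := NP _ (leq_maxr M N); rewrite /= norm_lt// sqr_sqrtr// ltW.
Qed.

Let u_var n h : (rdot h (u n) - F h) ^+ 2 <= (rdot h h + 1) * n.+1%:R^-1.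
Proof.
apply: discr => // t.
have := d_le (u n + t%:C%C *: h); have := u_lt n.
rewrite /q !(rdotDl, rdotDr, rdotZl, rdotZr, FZ, FD) (rdotC (u n) h).
move: (rdot (u n) (u n)) (rdot h (u n)) (rdot h h) => a b c.
move: d (F (u n)) (F h) (n.+1%:R^-1) => d' f g e; lra.
Qed.

Lemma riesz_real : exists z, forall x, F x = rdot x z.
Proof.
have [z zP] := u_cvg; exists z => h; apply/eqP; rewrite eq_sym -subr_eq0.
rewrite -sqrf_eq0 eq_le sqr_ge0 andbT; apply/ler_addgt0Pr => /= e e0; rewrite add0r.
pose c := 4 * (rdot h h + 1); have h0 := rdot_ge0 h.
have c0 : 0 < c by rewrite /c; lra.
have [n [ne zn]] := zP (e / c) (divr_gt0 e0 c0).
have := u_var n h; have := sqr_rdot h (z - u n).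
have -> : rdot h (z - u n) = rdot h z - rdot h (u n).
  by rewrite rdotDr linearNr raddfN.
move: ne zn; rewrite !ltr_pdivlMr// /c.
have := rdot_ge0 (z - u n).
move: (rdot (z - u n) (z - u n)) (rdot h z) (rdot h (u n)) (F h) (rdot h h) h0.
move=> w a b f N N0 w0 en wn ab bf.
have : 0 <= (a + f - 2 * b) ^+ 2 by exact: sqr_ge0.
move: (n.+1%:R^-1) en bf => m en bf; lra.
Qed.

End Riesz.

Let bop_rdot (T : 'B(H)) :
  exists2 r : R, 0 <= r & forall x, rdot (T x) (T x) <= r * rdot x x.
Proof.
have [M M0 TM] := bounded_map_ge0 (bop_bounded T).
have ME : M = (complex.Re M)%:C%C by rewrite RRe_real// ger0_real.
exists (complex.Re M ^+ 2) => [|x]; first exact: sqr_ge0.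
rewrite -lecR rmorphM rmorphXn /= -ME -!sqr_normE -exprMn.
by rewrite lerXn2r ?nnegrE// mulr_ge0.
Qed.

(* The imaginary parts agree because the real parts agree at 'i *: x. *)
Lemma adjoint_ex (T : 'B(H)) y : exists z, forall x, dotH (T x) y = dotH x z.
Proof.
have [r r0 Tr] := bop_rdot T.
have FD x x' : rdot (T (x + x')) y = rdot (T x) y + rdot (T x') y.
  by rewrite linearD rdotDl.
have FZ t x : rdot (T (t%:C%C *: x)) y = t * rdot (T x) y.
  by rewrite linearZ rdotZl.
have FB x : rdot (T x) y ^+ 2 <= r * rdot y y * rdot x x.
  by rewrite (le_trans (sqr_rdot _ _))// mulrAC ler_wpM2r.
have [z zP] := riesz_real FD FZ FB (mulr_ge0 r0 (rdot_ge0 y)).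
exists z => x; have := zP x; have := zP ('i%C *: x).
rewrite linearZ !linearZl_LR /=.
case: (dotH (T x) y) (dotH x z) => [a b] [c e] /=.
by rewrite !mul0r !mul1r !sub0r => /oppr_inj -> ->.
Qed.

Definition adjoint_fun (T : 'B(H)) y : H := sval (cid (adjoint_ex T y)).

Lemma adjoint_funP (T : 'B(H)) x y : dotH (T x) y = dotH x (adjoint_fun T y).
Proof. by rewrite /adjoint_fun; case: cid. Qed.

Lemma dotH_inj y z : (forall x, dotH x y = dotH x z) -> y = z.
Proof.
move=> yz; apply/eqP; rewrite -subr_eq0 -normr_eq0 -sqrf_eq0 sqr_norm_dotH.
by rewrite linearBr subr_eq0; apply/eqP/yz.
Qed.

Lemma adjoint_linear (T : 'B(H)) : linear (adjoint_fun T).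
Proof.
move=> a y z; apply: dotH_inj => x.
by rewrite -adjoint_funP !(linearDr, linearZr_LR) /= !adjoint_funP.
Qed.

Lemma adjoint_bounded (T : 'B(H)) : bounded_map (adjoint_fun T).
Proof.
have [r r0 Tr] := bop_rdot T.
exists (Num.sqrt r)%:C%C => y; set z := adjoint_fun T y.
rewrite -(@ler_pXn2r _ 2)// ?nnegrE ?mulr_ge0 ?ler0c ?sqrtr_ge0//.
rewrite exprMn -rmorphXn sqr_sqrtr// !sqr_normE -rmorphM lecR.
have zz : rdot z z = rdot (T z) y by rewrite adjoint_funP.
have : rdot z z ^+ 2 <= rdot z z * (r * rdot y y).
  by rewrite {1}zz (le_trans (sqr_rdot _ _))// mulrCA mulrA ler_wpM2r.
have [z0|z0] := ltP 0 (rdot z z); first by rewrite expr2 ler_pM2l.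
by move=> _; rewrite (le_trans z0)// mulr_ge0.
Qed.

Definition adjoint (T : 'B(H)) : 'B(H) :=
  BoundedOp (adjoint_linear T) (adjoint_bounded T).

Lemma adjointP (T : 'B(H)) x y : dotH (T x) y = dotH x (adjoint T y).
Proof. exact: adjoint_funP. Qed.

Lemma adjoint_uniq (S T : 'B(H)) :
  (forall x y, dotH (T x) y = dotH x (S y)) -> S = adjoint T.
Proof.
by move=> ST; apply: bopP => y; apply: dotH_inj => x; rewrite -ST adjointP.
Qed.

End Adjoint.

Section Classes.
Variables (R : realType) (H : hilbertType R).
Implicit Types A C D E : 'B(H).

Definition generalized_projection A := A ^+ 2 = adjoint A.

Definition idempotent_operator E := E ^+ 2 = E.

Definition star_le C D :=
  C * adjoint C = D * adjoint C /\ adjoint C * C = adjoint C * D.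

End Classes.

(* Main.v *)
Require Import Defs.
From mathcomp Require Import all_boot all_order all_algebra.
From mathcomp Require Import reals.

(** Write P for A A^*.  Taking adjoints in A^2 = A^* gives A^4 = A, so that
    P = A^3 is an orthogonal projection: P^* = P = P^2.

    The converse implication is then immediate: multiplying P = B + X by B^*
    on either side and using B^* X = X B^* = 0 gives the two equations of the
    star order.

    For the direct implication, the point is that an operator B below an
    orthogonal projection P is itself an orthogonal projection.  The equations
    B B^* = P B^* and P B = B^* B, the second one being the adjoint of
    B^* B = B^* P, evaluate P B B^* in two ways and yield B^* B B^* = B B^*
    ([star_le_projection_cube]).  This forces (B^* B - B)(B^* B - B)^* = 0,
    hence B = B^* B by the definiteness of T T^* ([mul_adjoint_eq0]), so that B
    is self-adjoint and idempotent ([star_le_projection_adjointM]).  Now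
    B P = P B = B, and X = P - B is the required idempotent. *)

Import GRing.Theory Num.Theory.
Local Open Scope ring_scope.

Section AdjointAlgebra.
Context {R : realType} {H : hilbertType R}.
Implicit Types S T : 'B(H).

Lemma adjointPl T x y : dotH (adjoint T x) y = dotH x (T y).
Proof. by rewrite dotHC -adjointP -dotHC. Qed.

Lemma adjointK : involutive (@adjoint R H).
Proof. by move=> T; apply/esym/adjoint_uniq => x y; rewrite adjointPl. Qed.

Lemma adjointM S T : adjoint (S * T) = adjoint T * adjoint S.
Proof.
by apply/esym/adjoint_uniq => x y; rewrite !bopME !adjointP.
Qed.

Lemma adjointB S T : adjoint (S - T) = adjoint S - adjoint T.
Proof.
apply/esym/adjoint_uniq => x y.
by rewrite !(bopDE, bopNE) linearBl linearBr /= !adjointP.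
Qed.

(** Definiteness of the form: the squared norm of T^* y is the inner product
    of T T^* y with y. *)
Lemma mul_adjoint_eq0 T : T * adjoint T = 0 -> T = 0.
Proof.
move=> TT0; apply: (can_inj adjointK); apply: bopP => y.
have -> : adjoint (0 : 'B(H)) = 0 by rewrite -(subrr T) adjointB !subrr.
rewrite bop0E; apply/eqP; rewrite -normr_eq0 -sqrf_eq0 sqr_norm_dotH -adjointP.
by rewrite -bopME TT0 bop0E linear0l.
Qed.

End AdjointAlgebra.

Section StarOrder.
Context {R : realType} {H : hilbertType R}.
Implicit Types A B P : 'B(H).

Lemma generalized_projection_expr4 A :
  generalized_projection A -> A ^+ 4 = A.
Proof.
move=> gA; rewrite -[RHS]adjointK -gA expr2 adjointM -gA.
by rewrite -exprD.
Qed.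

Lemma generalized_projection_idempotent A :
  generalized_projection A -> idempotent_operator (A * adjoint A).
Proof.
move=> gA; rewrite /idempotent_operator -gA -exprS -exprM.
by rewrite (exprD A 4 2) generalized_projection_expr4// -exprS.
Qed.

(** Both sides are values of P B B^*: the left one because P B = B^* B, the
    right one because B B^* = P B^* is fixed by P. *)
Lemma star_le_projection_cube P B :
  adjoint P = P -> idempotent_operator P -> star_le B P ->
  adjoint B * B * adjoint B = B * adjoint B.
Proof.
move=> aP iP [BBs BsB].
have PB : P * B = adjoint B * B.
  by rewrite -[LHS]adjointK adjointM aP -BsB adjointM adjointK.
by rewrite -PB -mulrA BBs mulrA -expr2 iP.
Qed.

(** With S = B^* B - B, the four terms of S S^* cancel in pairs once
    B^* B B^* is replaced by B B^*, so that S = 0. The conclusion is the form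
    to aim for because B^* B is self-adjoint: it makes B both self-adjoint and
    idempotent. *)
Lemma star_le_projection_adjointM P B :
  adjoint P = P -> idempotent_operator P -> star_le B P ->
  adjoint B * B = B.
Proof.
move=> aP iP BP; have cube := star_le_projection_cube _ _ aP iP BP.
apply/subr0_eq/mul_adjoint_eq0.
rewrite adjointB adjointM adjointK mulrBl !mulrBr !mulrA.
by rewrite cube subrr.
Qed.

End StarOrder.

Theorem corollary4p8 (R : realType) (H : hilbertType R) (A B : 'B(H)) :
  generalized_projection A ->
  (star_le B (A * adjoint A) <->
   idempotent_operator B /\
   exists X : 'B(H),
     [/\ idempotent_operator X, A * adjoint A = B + X,
         adjoint B * X = 0 & X * adjoint B = 0]).
Proof.
move=> gA; have := generalized_projection_idempotent _ gA.
have : adjoint (A * adjoint A) = A * adjoint A by rewrite adjointM adjointK.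
move: (A * adjoint A) => P aP iP; split=> [BP|[_ [X [_ -> BsX XBs]]]]; last first.
  by split; rewrite ?mulrDl ?mulrDr ?BsX ?XBs addr0.
have BsBE := star_le_projection_adjointM _ _ aP iP BP.
have aB : adjoint B = B by rewrite -[in LHS]BsBE adjointM adjointK.
case: BP => + +; rewrite aB in BsBE *; rewrite BsBE => PB BP.
split; first by rewrite /idempotent_operator expr2.
exists (P - B); split; last 2 first.
- by rewrite mulrBr -BP BsBE subrr.
- by rewrite mulrBl -PB BsBE subrr.
- rewrite /idempotent_operator expr2 mulrBl !mulrBr -PB -BP BsBE subrr subr0.
  by rewrite -expr2 iP.
- by rewrite addrC subrK.
Qed.
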